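(* Let $(\mathbb C,\otimes,I)$ be a cartesian closed category (with strict cartesian monoidal structure). Then the data $\mathsf S(\mathbb C)$ of stateful transformations in $\mathbb C$ is well-defined, i.e. it is a single-object double category.
   Context: Monoidal structures are strict (including the cartesian product $\otimes$ with terminal object $I$), and composites are in diagrammatic order ($fg$ is first $f$, then $g$). $\sigma_{A,B}:A\otimes B\to B\otimes A$ is the symmetry. A single-object double category $\mathbb D$ has a horizontal edge monoid $(\mathbb D_H,\otimes,I)$, a vertical edge monoid $(\mathbb D_V,\otimes,I)$, and for $A,B\in\mathbb D_H$, $U,W\in\mathbb D_V$ a set of cells $(U;A;B;W)$ (left; top; bottom; right boundary). For $\alpha:(U;A;B;V)$ and $\beta:(V;A';B';W)$ there is a horizontal composite $\alpha\mid\beta:(U;A\otimes A';B\otimes B';W)$; for $\alpha:(U;A;C;W)$ and $\beta:(U';C;B;W')$ a vertical composite $\frac{\alpha}{\beta}:(U\otimes U';A;B;W\otimes W')$. Both are associative and unital, with horizontal units $id_U:(U;I;I;U)$ and vertical units $1_A:(I;A;A;I)$, where $id_I=1_I$, $1_{A\otimes B}=1_A\mid 1_B$, $id_{U\otimes W}=\frac{id_U}{id_W}$, and interchange $\frac{\alpha}{\beta}\mid\frac{\gamma}{\delta}=\frac{\alpha\mid\gamma}{\beta\mid\delta}$ holds. A strong functor $(F,\tau^F):\mathbb C\to\mathbb C$ is a functor $F$ with a natural transformation $\tau^F_{X,Y}:FX\otimes Y\to F(X\otimes Y)$ such that $\tau^F_{X,I}=1_{FX}$ and $(\tau^F_{X,Y}\otimes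 1_Z)\,\tau^F_{X\otimes Y,Z}=\tau^F_{X,Y\otimes Z}$. The identity functor has strength $1_{X\otimes Y}$; the composite $F\circ G$, $(F\circ G)(X)=F(G(X))$, has strength $\tau^{F}_{GX,Y}\,F(\tau^{G}_{X,Y})$. A strong natural transformation $\alpha:(F,\tau^F)\to(G,\tau^G)$ is a natural transformation with $(\alpha_X\otimes 1_Y)\tau^G_{X,Y}=\tau^F_{X,Y}\alpha_{X\otimes Y}$. For an object $A$, $A^\circ=(-\otimes A)$ is strong with $\tau^{A^\circ}_{X,Y}=1_X\otimes\sigma_{A,Y}$. $\mathsf S(\mathbb C)$: horizontal edge monoid $(\mathbb C_0,\otimes,I)$ (objects under cartesian product); vertical edge monoid the strong endofunctors of $\mathbb C$ under composition $(F,H)\mapsto F\circ H$, with unit $I$ the identity functor. Cells $(U;A;B;W)$ are strong natural transformations $A^\circ\circ U\to W\circ B^\circ$, i.e. with components $\alpha_X:UX\otimes A\to W(X\otimes B)$. For $\alpha:(F;A;B;G)$ and $\beta:(G;A';B';H)$, $(\alpha\mid\beta)_X=(\alpha_X\otimes 1_{A'})\,\beta_{X\otimes B}$, and $(id_F)_X=1_{FX}$. For $\alpha:(F;A;B;G)$ and $\beta:(H;B;C;K)$, $\left(\frac{\alpha}{\beta}\right)_X=\alpha_{HX}\,G(\beta_X):F(H(X))\otimes A\to G(K(X\otimes C))$, and $(1_A)_X=1_{X\otimes A}$. *)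

(* Defs.v *)
From Stdlib Require Import ProofIrrelevance.

Set Implicit Arguments.
Unset Strict Implicit.

Declare Scope stateful_scope.
Delimit Scope stateful_scope with stateful.
Open Scope stateful_scope.

Record Category : Type := {
  Ob :> Type;
  Hom : Ob -> Ob -> Type;
  id : forall A : Ob, Hom A A;
  comp : forall A B C : Ob, Hom A B -> Hom B C -> Hom A C;
  comp_id_l : forall (A B : Ob) (f : Hom A B), comp (id A) f = f;
  comp_id_r : forall (A B : Ob) (f : Hom A B), comp f (id B) = f;
  comp_assoc : forall (A B C D : Ob) (f : Hom A B) (g : Hom B C) (h : Hom C D),
    comp f (comp g h) = comp (comp f g) h
}.

Arguments Hom {_} _ _.
Arguments id {_} _.
Arguments comp {_ A B C} _ _.

(* Diagrammatic order. *)
Notation "f ;; g" := (comp f g)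
  (at level 50, left associativity) : stateful_scope.

(* Equality of arrows of C: same domain, same codomain, same morphism.  It is
   needed because in a strict monoidal category the objects (A * B) * C and
   A * (B * C) are equal but not convertible. *)
Inductive hom_eq {C : Category} {A B : C} (f : Hom A B) :
  forall A' B' : C, Hom A' B' -> Prop :=
| hom_eq_refl : @hom_eq C A B f A B f.

Arguments hom_eq {C A B} f {A' B'} _.
Notation "f ≡ g" := (hom_eq f g) (at level 70, no associativity) : stateful_scope.

Definition hcast {C : Category} {A A' B B' : C} (eA : A = A') (eB : B = B')
  (f : Hom A B) : Hom A' B' :=
  match eA in _ = X, eB in _ = Y return Hom X Y with
  | eq_refl, eq_refl => f
  end.

Record CartesianCategory : Type := {
  cart_cat :> Category;
  unit_ob : cart_cat;
  terminal : forall A : cart_cat, Hom A unit_ob;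
  terminal_unique : forall (A : cart_cat) (f : Hom A unit_ob), f = terminal A;
  prod_ob : cart_cat -> cart_cat -> cart_cat;
  proj1 : forall A B : cart_cat, Hom (prod_ob A B) A;
  proj2 : forall A B : cart_cat, Hom (prod_ob A B) B;
  pair : forall X A B : cart_cat, Hom X A -> Hom X B -> Hom X (prod_ob A B);
  pair_proj1 : forall (X A B : cart_cat) (f : Hom X A) (g : Hom X B),
    pair f g ;; proj1 A B = f;
  pair_proj2 : forall (X A B : cart_cat) (f : Hom X A) (g : Hom X B),
    pair f g ;; proj2 A B = g;
  pair_unique : forall (X A B : cart_cat) (h : Hom X (prod_ob A B)),
    h = pair (h ;; proj1 A B) (h ;; proj2 A B)
}.

Arguments unit_ob {_}.
Arguments terminal {_} _.
Arguments prod_ob {_} _ _.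
Arguments proj1 {_} _ _.
Arguments proj2 {_} _ _.
Arguments pair {_ X A B} _ _.

Notation "A ⊗ B" := (prod_ob A B)
  (at level 40, left associativity) : stateful_scope.

Definition tensor {C : CartesianCategory} {A B A' B' : C}
  (f : Hom A A') (g : Hom B B') : Hom (A ⊗ B) (A' ⊗ B') :=
  pair (proj1 A B ;; f) (proj2 A B ;; g).

Notation "f ⊠ g" := (tensor f g)
  (at level 40, left associativity) : stateful_scope.

Definition symmetry {C : CartesianCategory} (A B : C) : Hom (A ⊗ B) (B ⊗ A) :=
  pair (proj2 A B) (proj1 A B).

Definition associator {C : CartesianCategory} (A B D : C) :
  Hom (A ⊗ B ⊗ D) (A ⊗ (B ⊗ D)) :=
  pair (proj1 (A ⊗ B) D ;; proj1 A B)
       (pair (proj1 (A ⊗ B) D ;; proj2 A B) (proj2 (A ⊗ B) D)).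

(* The canonical associators and unitors are identity arrows. *)
Record StrictCartesianCategory : Type := {
  strict_cart :> CartesianCategory;
  strict_assoc : forall A B D : strict_cart,
    associator A B D ≡ id (A ⊗ B ⊗ D);
  strict_unit_l : forall A : strict_cart, proj2 unit_ob A ≡ id A;
  strict_unit_r : forall A : strict_cart, proj1 A unit_ob ≡ id A
}.

Record StrictCCC : Type := {
  ccc_cart :> StrictCartesianCategory;
  exp_ob : ccc_cart -> ccc_cart -> ccc_cart;
  eval : forall A B : ccc_cart, Hom (exp_ob A B ⊗ A) B;
  curry : forall X A B : ccc_cart, Hom (X ⊗ A) B -> Hom X (exp_ob A B);
  curry_eval : forall (X A B : ccc_cart) (f : Hom (X ⊗ A) B),
    (curry f ⊠ id A) ;; eval A B = f;
  curry_unique : forall (X A B : ccc_cart) (h : Hom X (exp_ob A B)),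
    h = curry ((h ⊠ id A) ;; eval A B)
}.

Lemma hom_eq_inv {C : Category} {A B A' B' : C} (f : Hom A B) (g : Hom A' B') :
  f ≡ g -> exists (eA : A = A') (eB : B = B'), hcast eA eB f = g.
Proof. intros []. now exists eq_refl, eq_refl. Qed.

Lemma hom_eq_eq {C : Category} {A B : C} (f g : Hom A B) : f ≡ g -> f = g.
Proof.
intros H. destruct (hom_eq_inv H) as [eA [eB E]].
now rewrite (proof_irrelevance _ eA eq_refl),
  (proof_irrelevance _ eB eq_refl) in E.
Qed.

Lemma eq_hom_eq {C : Category} {A B : C} (f g : Hom A B) : f = g -> f ≡ g.
Proof. intros ->. apply hom_eq_refl. Qed.

Lemma hom_eq_sym {C : Category} {A B A' B' : C} (f : Hom A B) (g : Hom A' B') :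
  f ≡ g -> g ≡ f.
Proof. intros []. apply hom_eq_refl. Qed.

Lemma hom_eq_trans {C : Category} {A B A' B' A'' B'' : C}
  (f : Hom A B) (g : Hom A' B') (h : Hom A'' B'') : f ≡ g -> g ≡ h -> f ≡ h.
Proof. now intros []. Qed.

Lemma hcast_hom_eq {C : Category} {A A' B B' : C} (eA : A = A') (eB : B = B')
  (f : Hom A B) : hcast eA eB f ≡ f.
Proof. destruct eA, eB. apply hom_eq_refl. Qed.

Lemma id_hom_eq {C : Category} (A B : C) : A = B -> id A ≡ id B.
Proof. intros []. apply hom_eq_refl. Qed.

Lemma hom_eq_comp {C : Category} {A B D A' B' D' : C}
  (f : Hom A B) (g : Hom B D) (f' : Hom A' B') (g' : Hom B' D') :
  f ≡ f' -> g ≡ g' -> f ;; g ≡ f' ;; g'.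
Proof.
intros H1 H2.
destruct (hom_eq_inv H1) as [eA [eB E1]].
destruct (hom_eq_inv H2) as [eB' [eD E2]].
destruct eA, eB, eD. rewrite (proof_irrelevance _ eB' eq_refl) in E2.
simpl in *. subst. apply hom_eq_refl.
Qed.

Lemma hom_eq_tensor {C : CartesianCategory} {A B D E A' B' D' E' : C}
  (f : Hom A B) (g : Hom D E) (f' : Hom A' B') (g' : Hom D' E') :
  f ≡ f' -> g ≡ g' -> f ⊠ g ≡ f' ⊠ g'.
Proof. intros [] []. apply hom_eq_refl. Qed.

Lemma hom_eq_cod {C : Category} {A B A' B' : C} (f : Hom A B) (g : Hom A' B') :
  f ≡ g -> B = B'.
Proof. now intros []. Qed.

Lemma hom_eq_dom {C : Category} {A B A' B' : C} (f : Hom A B) (g : Hom A' B') :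
  f ≡ g -> A = A'.
Proof. now intros []. Qed.

Lemma comp_strict_l {C : Category} {A B A' D : C}
  (a : Hom A B) (f : Hom B D) : a ≡ id A' -> a ;; f ≡ f.
Proof.
intros H. destruct (hom_eq_dom H).
destruct (hom_eq_inv (hom_eq_sym H)) as [e1 [e2 E]]. destruct e2.
rewrite (proof_irrelevance _ e1 eq_refl) in E. simpl in E. subst a.
rewrite comp_id_l. apply hom_eq_refl.
Qed.

Lemma comp_strict_r {C : Category} {A B A' D : C}
  (f : Hom D A) (a : Hom A B) : a ≡ id A' -> f ;; a ≡ f.
Proof.
intros H. destruct (hom_eq_dom H).
destruct (hom_eq_inv (hom_eq_sym H)) as [e1 [e2 E]]. destruct e2.
rewrite (proof_irrelevance _ e1 eq_refl) in E. simpl in E. subst a.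
rewrite comp_id_r. apply hom_eq_refl.
Qed.

Lemma assoc_ob {C : StrictCartesianCategory} (A B D : C) :
  A ⊗ B ⊗ D = A ⊗ (B ⊗ D).
Proof. symmetry. exact (hom_eq_cod (strict_assoc A B D)). Qed.

Lemma pair_ext {C : CartesianCategory} {X A B : C} (f g : Hom X (A ⊗ B)) :
  f ;; proj1 A B = g ;; proj1 A B -> f ;; proj2 A B = g ;; proj2 A B -> f = g.
Proof. intros H1 H2. now rewrite (pair_unique f), (pair_unique g), H1, H2. Qed.

Lemma tensor_proj1 {C : CartesianCategory} {A B A' B' : C}
  (f : Hom A A') (g : Hom B B') : (f ⊠ g) ;; proj1 A' B' = proj1 A B ;; f.
Proof. apply pair_proj1. Qed.

Lemma tensor_proj2 {C : CartesianCategory} {A B A' B' : C}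
  (f : Hom A A') (g : Hom B B') : (f ⊠ g) ;; proj2 A' B' = proj2 A B ;; g.
Proof. apply pair_proj2. Qed.

Lemma comp_pair {C : CartesianCategory} {Y X A B : C}
  (h : Hom Y X) (f : Hom X A) (g : Hom X B) : h ;; pair f g = pair (h ;; f) (h ;; g).
Proof.
apply pair_ext; now rewrite <- comp_assoc, ?pair_proj1, ?pair_proj2.
Qed.

Lemma pair_tensor {C : CartesianCategory} {X A B A' B' : C}
  (f : Hom X A) (g : Hom X B) (h : Hom A A') (k : Hom B B') :
  pair f g ;; (h ⊠ k) = pair (f ;; h) (g ;; k).
Proof.
unfold tensor. now rewrite comp_pair, !comp_assoc, pair_proj1, pair_proj2.
Qed.

Lemma tensor_comp {C : CartesianCategory} {A B D A' B' D' : C}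
  (f : Hom A B) (g : Hom B D) (f' : Hom A' B') (g' : Hom B' D') :
  (f ;; g) ⊠ (f' ;; g') = (f ⊠ f') ;; (g ⊠ g').
Proof. unfold tensor at 2. now rewrite pair_tensor, <- !comp_assoc. Qed.

Lemma tensor_id {C : CartesianCategory} (A B : C) : id A ⊠ id B = id (A ⊗ B).
Proof.
apply pair_ext; now rewrite ?tensor_proj1, ?tensor_proj2, comp_id_r, comp_id_l.
Qed.

Lemma symmetry_natural {C : CartesianCategory} {A B A' B' : C}
  (f : Hom A A') (g : Hom B B') :
  (f ⊠ g) ;; symmetry A' B' = symmetry A B ;; (g ⊠ f).
Proof.
unfold symmetry. now rewrite comp_pair, pair_tensor, tensor_proj1, tensor_proj2.
Qed.

Lemma associator_natural {C : CartesianCategory} {A B D A' B' D' : C}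
  (f : Hom A A') (g : Hom B B') (h : Hom D D') :
  (f ⊠ g ⊠ h) ;; associator A' B' D' = associator A B D ;; (f ⊠ (g ⊠ h)).
Proof.
unfold associator.
rewrite !pair_tensor, !comp_pair, !comp_assoc, !tensor_proj1, !tensor_proj2.
now rewrite <- !comp_assoc, !tensor_proj1, !tensor_proj2.
Qed.

Lemma symmetry_hexagon {C : CartesianCategory} (A Y Z : C) :
  (symmetry A Y ⊠ id Z) ;; associator Y A Z ;; (id Y ⊠ symmetry A Z) =
  associator A Y Z ;; symmetry A (Y ⊗ Z) ;; associator Y Z A.
Proof.
unfold associator, symmetry.
rewrite <- comp_assoc, !pair_tensor, !comp_pair, !comp_id_r, !pair_proj1,
  !pair_proj2.
rewrite !comp_assoc, !tensor_proj1, !tensor_proj2, <- !comp_assoc, ?pair_proj1,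
  ?pair_proj2, ?comp_id_r.
rewrite !comp_assoc, ?pair_proj1, ?pair_proj2.
reflexivity.
Qed.

Lemma tensor_assoc {C : StrictCartesianCategory} {A B D A' B' D' : C}
  (f : Hom A A') (g : Hom B B') (h : Hom D D') : f ⊠ g ⊠ h ≡ f ⊠ (g ⊠ h).
Proof.
eapply hom_eq_trans; [|exact (comp_strict_l _ (strict_assoc A B D))].
rewrite <- associator_natural.
apply hom_eq_sym, (comp_strict_r _ (strict_assoc A' B' D')).
Qed.

Lemma symmetry_unit {C : StrictCartesianCategory} (A : C) :
  symmetry A unit_ob ≡ id A.
Proof.
eapply hom_eq_trans; [|exact (strict_unit_r A)].
rewrite <- (pair_proj2 (proj2 A unit_ob) (proj1 A unit_ob)).
apply hom_eq_sym, (comp_strict_r _ (strict_unit_l A)).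
Qed.

Record StrongFunctor (C : StrictCartesianCategory) : Type := {
  fob :> C -> C;
  fmap : forall X Y : C, Hom X Y -> Hom (fob X) (fob Y);
  fmap_id : forall X : C, fmap (id X) = id (fob X);
  fmap_comp : forall (X Y Z : C) (f : Hom X Y) (g : Hom Y Z),
    fmap (f ;; g) = fmap f ;; fmap g;
  strength : forall X Y : C, Hom (fob X ⊗ Y) (fob (X ⊗ Y));
  strength_natural : forall (X X' Y Y' : C) (f : Hom X X') (g : Hom Y Y'),
    (fmap f ⊠ g) ;; strength X' Y' = strength X Y ;; fmap (f ⊠ g);
  strength_unit : forall X : C, strength X unit_ob ≡ id (fob X);
  strength_assoc : forall X Y Z : C,
    (strength X Y ⊠ id Z) ;; strength (X ⊗ Y) Z ≡ strength X (Y ⊗ Z)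
}.

Arguments fmap {C} _ {X Y} _.
Arguments strength {C} _ _ _.

Lemma fmap_hom_eq {C : StrictCartesianCategory} (F : StrongFunctor C)
  {A B A' B' : C} (f : Hom A B) (g : Hom A' B') : f ≡ g -> fmap F f ≡ fmap F g.
Proof. intros []. apply hom_eq_refl. Qed.

Definition strong_id (C : StrictCartesianCategory) : StrongFunctor C.
Proof.
refine {|
  fob := fun X : C => X;
  fmap := fun (X Y : C) (f : Hom X Y) => f;
  strength := fun X Y : C => id (X ⊗ Y)
|}.
- reflexivity.
- reflexivity.
- intros. now rewrite comp_id_l, comp_id_r.
- intros X. apply id_hom_eq. exact (hom_eq_dom (strict_unit_r X)).
- intros X Y Z. rewrite tensor_id, comp_id_l. apply id_hom_eq, assoc_ob.
Defined.

(* [strong_comp F G] is F o G: it sends X to F (G X). *)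
Definition strong_comp {C : StrictCartesianCategory} (F G : StrongFunctor C) :
  StrongFunctor C.
Proof.
refine {|
  fob := fun X : C => F (G X);
  fmap := fun (X Y : C) (f : Hom X Y) => fmap F (fmap G f);
  strength := fun X Y : C => strength F (G X) Y ;; fmap F (strength G X Y)
|}.
- intros. now rewrite !fmap_id.
- intros. now rewrite !fmap_comp.
- intros. now rewrite comp_assoc, strength_natural, <- !comp_assoc, <- !fmap_comp,
    strength_natural.
- intros X.
  eapply hom_eq_trans.
  + eapply hom_eq_comp; [apply strength_unit|].
    apply fmap_hom_eq, strength_unit.
  + rewrite fmap_id, comp_id_l. apply hom_eq_refl.
- intros X Y Z.
  rewrite <- (comp_id_l (id Z)), tensor_comp, <- comp_assoc.
  rewrite (comp_assoc (fmap F (strength G X Y) ⊠ id Z)), strength_natural.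
  rewrite <- comp_assoc, <- fmap_comp, comp_assoc.
  apply hom_eq_comp; [apply strength_assoc|].
  apply fmap_hom_eq, strength_assoc.
Defined.

(* The strength at (X, Y) is id X ⊠ symmetry A Y : X ⊗ (A ⊗ Y) -> X ⊗ (Y ⊗ A),
   read as an arrow (X ⊗ A) ⊗ Y -> (X ⊗ Y) ⊗ A. *)
Definition strong_tensor {C : StrictCartesianCategory} (A : C) : StrongFunctor C.
Proof.
refine {|
  fob := fun X : C => X ⊗ A;
  fmap := fun (X Y : C) (f : Hom X Y) => f ⊠ id A;
  strength := fun X Y : C =>
    hcast (eq_sym (assoc_ob X A Y)) (eq_sym (assoc_ob X Y A))
      (id X ⊠ symmetry A Y)
|}.
- intros. apply tensor_id.
- intros. now rewrite <- tensor_comp, comp_id_l.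
- intros X X' Y Y' f g. apply hom_eq_eq.
  eapply hom_eq_trans.
  { eapply hom_eq_comp; [apply tensor_assoc|apply hcast_hom_eq]. }
  eapply hom_eq_trans.
  2:{ eapply hom_eq_comp; [apply hom_eq_sym, hcast_hom_eq|
        apply hom_eq_sym, tensor_assoc]. }
  rewrite <- !tensor_comp, symmetry_natural, comp_id_l, comp_id_r.
  apply hom_eq_refl.
- intros X. eapply hom_eq_trans; [apply hcast_hom_eq|].
  rewrite <- tensor_id.
  apply hom_eq_tensor; [apply hom_eq_refl|apply symmetry_unit].
- intros X Y Z.
  eapply hom_eq_trans; [|apply hom_eq_sym, hcast_hom_eq].
  assert (H : symmetry A (Y ⊗ Z) ≡
    (symmetry A Y ⊠ id Z) ;; associator Y A Z ;; (id Y ⊠ symmetry A Z)).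
  { rewrite symmetry_hexagon.
    eapply hom_eq_trans;
      [|apply hom_eq_sym, (comp_strict_r _ (strict_assoc Y Z A))].
    apply hom_eq_sym, (comp_strict_l _ (strict_assoc A Y Z)). }
  eapply hom_eq_trans.
  2:{ eapply hom_eq_tensor; [apply hom_eq_refl|apply hom_eq_sym, H]. }
  assert (E : id X ⊠ ((symmetry A Y ⊠ id Z) ;; associator Y A Z ;;
      (id Y ⊠ symmetry A Z)) =
    (id X ⊠ (symmetry A Y ⊠ id Z)) ;; (id X ⊠ associator Y A Z) ;;
      (id X ⊠ (id Y ⊠ symmetry A Z))) by now rewrite <- !tensor_comp, !comp_id_l.
  rewrite E.
  apply hom_eq_comp.
  + eapply hom_eq_trans.
    { eapply hom_eq_tensor; [apply hcast_hom_eq|apply hom_eq_refl]. }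
    eapply hom_eq_trans; [apply tensor_assoc|].
    apply hom_eq_sym, (comp_strict_r (A' := X ⊗ (Y ⊗ A ⊗ Z))).
    rewrite <- tensor_id. apply hom_eq_tensor; [apply hom_eq_refl|].
    apply strict_assoc.
  + eapply hom_eq_trans; [apply hcast_hom_eq|].
    rewrite <- tensor_id. apply tensor_assoc.
Defined.

Record StrongNat {C : StrictCartesianCategory} (F G : StrongFunctor C) : Type := {
  component :> forall X : C, Hom (F X) (G X);
  component_natural : forall (X Y : C) (f : Hom X Y),
    fmap F f ;; component Y = component X ;; fmap G f;
  component_strong : forall X Y : C,
    (component X ⊠ id Y) ;; strength G X Y = strength F X Y ;; component (X ⊗ Y)
}.

Record Boundaries : Type := {
  hedge : Type;
  hmul : hedge -> hedge -> hedge;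
  hone : hedge;
  vedge : Type;
  vmul : vedge -> vedge -> vedge;
  vone : vedge;
  (* left; top; bottom; right *)
  cell : vedge -> hedge -> hedge -> vedge -> Type
}.

Arguments hmul {_} _ _.
Arguments hone {_}.
Arguments vmul {_} _ _.
Arguments vone {_}.
Arguments cell {_} _ _ _ _.

Record CellOperations (D : Boundaries) : Type := {
  hcomp : forall (U V W : vedge D) (A B A' B' : hedge D),
    cell U A B V -> cell V A' B' W -> cell U (hmul A A') (hmul B B') W;
  hunit : forall U : vedge D, cell U hone hone U;
  vcomp : forall (U U' W W' : vedge D) (A B C : hedge D),
    cell U A C W -> cell U' C B W' -> cell (vmul U U') A B (vmul W W');
  vunit : forall A : hedge D, cell vone A A vone
}.

Arguments hcomp {D} _ {U V W A B A' B'} _ _.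
Arguments hunit {D} _ _.
Arguments vcomp {D} _ {U U' W W' A B C} _ _.
Arguments vunit {D} _ _.

(* Equality of cells: same four boundaries, same cell. *)
Inductive cell_eq {D : Boundaries} {U : vedge D} {A B : hedge D} {W : vedge D}
  (a : cell U A B W) :
  forall (U' : vedge D) (A' B' : hedge D) (W' : vedge D),
    cell U' A' B' W' -> Prop :=
| cell_eq_refl : @cell_eq D U A B W a U A B W a.

Arguments cell_eq {D U A B W} a {U' A' B' W'} _.

Record is_monoid (M : Type) (mul : M -> M -> M) (one : M) : Prop := {
  monoid_assoc : forall x y z : M, mul x (mul y z) = mul (mul x y) z;
  monoid_unit_l : forall x : M, mul one x = x;
  monoid_unit_r : forall x : M, mul x one = x
}.

Record is_single_object_double_category (D : Boundaries) (S : CellOperations D) :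
  Prop := {
  hedge_monoid : is_monoid (@hmul D) hone;
  vedge_monoid : is_monoid (@vmul D) vone;
  hcomp_assoc : forall (U V W Z : vedge D) (A B A' B' A'' B'' : hedge D)
    (a : cell U A B V) (b : cell V A' B' W) (c : cell W A'' B'' Z),
    cell_eq (hcomp S a (hcomp S b c)) (hcomp S (hcomp S a b) c);
  hcomp_unit_l : forall (U W : vedge D) (A B : hedge D) (a : cell U A B W),
    cell_eq (hcomp S (hunit S U) a) a;
  hcomp_unit_r : forall (U W : vedge D) (A B : hedge D) (a : cell U A B W),
    cell_eq (hcomp S a (hunit S W)) a;
  vcomp_assoc : forall (U U' U'' W W' W'' : vedge D) (A B C E : hedge D)
    (a : cell U A B W) (b : cell U' B C W') (c : cell U'' C E W''),
    cell_eq (vcomp S a (vcomp S b c)) (vcomp S (vcomp S a b) c);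
  vcomp_unit_l : forall (U W : vedge D) (A B : hedge D) (a : cell U A B W),
    cell_eq (vcomp S (vunit S A) a) a;
  vcomp_unit_r : forall (U W : vedge D) (A B : hedge D) (a : cell U A B W),
    cell_eq (vcomp S a (vunit S B)) a;
  unit_unit : hunit S vone = vunit S hone;
  vunit_hmul : forall A B : hedge D,
    vunit S (hmul A B) = hcomp S (vunit S A) (vunit S B);
  hunit_vmul : forall U W : vedge D,
    hunit S (vmul U W) = vcomp S (hunit S U) (hunit S W);
  interchange : forall (U V W U' V' W' : vedge D) (A B C A' B' C' : hedge D)
    (a : cell U A C V) (b : cell U' C B V')
    (c : cell V A' C' W) (d : cell V' C' B' W'),
    hcomp S (vcomp S a b) (vcomp S c d) = vcomp S (hcomp S a c) (hcomp S b d)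
}.

Definition stateful_boundaries (C : StrictCCC) : Boundaries := {|
  hedge := C;
  hmul := fun A B : C => A ⊗ B;
  hone := unit_ob;
  vedge := StrongFunctor C;
  vmul := fun F H : StrongFunctor C => strong_comp F H;
  vone := strong_id C;
  cell := fun (U : StrongFunctor C) (A B : C) (W : StrongFunctor C) =>
    StrongNat (strong_comp (strong_tensor A) U) (strong_comp W (strong_tensor B))
|}.

(* A strong natural transformation is determined by its components, so at most
   one family of operations satisfies this; that one exists at all means that
   the right-hand sides are components of strong natural transformations. *)
Record is_stateful_operations (C : StrictCCC)
  (S : CellOperations (stateful_boundaries C)) : Prop := {
  stateful_hcomp : forall (F G H : StrongFunctor C) (A B A' B' : C)
    (a : @cell (stateful_boundaries C) F A B G)
    (b : @cell (stateful_boundaries C) G A' B' H) (X : C),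
    component (hcomp S a b) X ≡ (component a X ⊠ id A') ;; component b (X ⊗ B);
  stateful_hunit : forall (F : StrongFunctor C) (X : C),
    component (hunit S F) X ≡ id (F X);
  stateful_vcomp : forall (F G H K : StrongFunctor C) (A B E : C)
    (a : @cell (stateful_boundaries C) F A B G)
    (b : @cell (stateful_boundaries C) H B E K) (X : C),
    component (vcomp S a b) X = component a (H X) ;; fmap G (component b X);
  stateful_vunit : forall (A X : C), component (vunit S A) X = id (X ⊗ A)
}.

(* Main.v *)
(* Strictness makes the canonical associators identity arrows, so the horizontal
   composite can be written with explicit associators; that it is strong then
   only uses equations between arrows with the same domain and codomain, the key
   one being that exchanging A ⊗ A' with Y amounts to exchanging first A' and
   then A with Y.  The double category laws compare cells whose boundaries are
   only propositionally equal; they reduce to a comparison of components up to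
   [≡], where all associators disappear. *)

From Stdlib Require Import ProofIrrelevance FunctionalExtensionality.
Require Import Defs.

(** * Rearranging factors in a cartesian category *)

Definition associator_inv {C : CartesianCategory} (A B D : C) :
  Hom (A ⊗ (B ⊗ D)) (A ⊗ B ⊗ D) :=
  pair (pair (proj1 A (B ⊗ D)) (proj2 A (B ⊗ D) ;; proj1 B D))
       (proj2 A (B ⊗ D) ;; proj2 B D).

(** The strength of [strong_tensor A] without its casts: between left-bracketed products the swap
    makes sense even without strictness. *)
Definition exchange {C : CartesianCategory} (X A Y : C) :
  Hom (X ⊗ A ⊗ Y) (X ⊗ Y ⊗ A) :=
  pair (pair (proj1 (X ⊗ A) Y ;; proj1 X A) (proj2 (X ⊗ A) Y))
       (proj1 (X ⊗ A) Y ;; proj2 X A).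

Section CartesianIdentities.
Context {C : CartesianCategory}.
Implicit Types A B D X Y : C.

Lemma pair_proj1_comp {X A B D} (f : Hom X A) (g : Hom X B) (h : Hom A D) :
  pair f g ;; (proj1 A B ;; h) = f ;; h.
Proof. now rewrite comp_assoc, pair_proj1. Qed.

Lemma pair_proj2_comp {X A B D} (f : Hom X A) (g : Hom X B) (h : Hom B D) :
  pair f g ;; (proj2 A B ;; h) = g ;; h.
Proof. now rewrite comp_assoc, pair_proj2. Qed.

(** Arrows into nested products agree once all their projections do, and after projecting both sides
    normalise. *)
Ltac cartesian :=
  unfold associator, associator_inv, exchange, symmetry, tensor;
  repeat apply pair_ext;
  repeat progress rewrite ?comp_pair, <- ?comp_assoc, ?pair_proj1, ?pair_proj2,
    ?pair_proj1_comp, ?pair_proj2_comp, ?comp_id_r, ?comp_id_l;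
  try reflexivity.

Lemma tensor_id_comp {A B D} (f : Hom A B) (g : Hom B D) (E : C) :
  (f ;; g) ⊠ id E = (f ⊠ id E) ;; (g ⊠ id E).
Proof. now rewrite <- tensor_comp, comp_id_l. Qed.

Lemma associator_inv_l A B D :
  associator_inv A B D ;; associator A B D = id (A ⊗ (B ⊗ D)).
Proof. cartesian. Qed.

Lemma associator_inv_r A B D :
  associator A B D ;; associator_inv A B D = id (A ⊗ B ⊗ D).
Proof. cartesian. Qed.

Lemma associator_inv_natural {A B D A' B' D' : C}
  (f : Hom A A') (g : Hom B B') (h : Hom D D') :
  (f ⊠ (g ⊠ h)) ;; associator_inv A' B' D' =
  associator_inv A B D ;; (f ⊠ g ⊠ h).
Proof. cartesian. Qed.

Lemma exchange_natural {X A Y X' A' Y' : C}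
  (f : Hom X X') (g : Hom A A') (h : Hom Y Y') :
  (f ⊠ g ⊠ h) ;; exchange X' A' Y' = exchange X A Y ;; (f ⊠ h ⊠ g).
Proof. cartesian. Qed.

(** For the strength of a horizontal composite: this identity splits the exchange on the bottom
    boundary, and [associator_inv_exchange] reassembles the one on the top. *)
Lemma associator_exchange X A B Y :
  (associator X A B ⊠ id Y) ;; exchange X (A ⊗ B) Y =
  exchange (X ⊗ A) B Y ;; (exchange X A Y ⊠ id B) ;; associator (X ⊗ Y) A B.
Proof. cartesian. Qed.

Lemma associator_inv_exchange X A B Y :
  (associator_inv X A B ⊠ id Y) ;; exchange (X ⊗ A) B Y ;;
    (exchange X A Y ⊠ id B) =
  exchange X (A ⊗ B) Y ;; associator_inv (X ⊗ Y) A B.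
Proof. cartesian. Qed.

Lemma exchange_associator X A Y :
  exchange X A Y =
  associator X A Y ;; (id X ⊠ symmetry A Y) ;; associator_inv X Y A.
Proof. cartesian. Qed.

End CartesianIdentities.

(** * Consequences of strictness; extensionality of strong functors and transformations *)

Section Strictness.
Context {C : StrictCartesianCategory}.
Implicit Types A B D X Y : C.

Lemma unit_r_ob A : A ⊗ unit_ob = A.
Proof. exact (hom_eq_dom (strict_unit_r A)). Qed.

Lemma unit_l_ob A : unit_ob ⊗ A = A.
Proof. exact (hom_eq_dom (strict_unit_l A)). Qed.

Lemma strict_assoc_inv A B D : associator_inv A B D ≡ id (A ⊗ B ⊗ D).
Proof.
rewrite <- (associator_inv_r A B D).
apply hom_eq_sym, (comp_strict_l _ (strict_assoc A B D)).
Qed.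

(** Naturality of [proj1], which is an identity arrow at the unit object. *)
Lemma tensor_unit_r {A B} (f : Hom A B) : f ⊠ id unit_ob ≡ f.
Proof.
eapply hom_eq_trans.
{ apply hom_eq_sym, (comp_strict_r _ (strict_unit_r B)). }
rewrite tensor_proj1. apply (comp_strict_l _ (strict_unit_r A)).
Qed.

(** The casts on the left and the associators that [exchange_associator] puts on the right both
    vanish up to [≡]. *)
Lemma strength_strong_tensor A X Y :
  strength (strong_tensor A) X Y = exchange X A Y.
Proof.
apply hom_eq_eq. eapply hom_eq_trans; [apply hcast_hom_eq|].
rewrite exchange_associator. apply hom_eq_sym.
eapply hom_eq_trans; [apply (comp_strict_r _ (strict_assoc_inv X Y A))|].
apply (comp_strict_l _ (strict_assoc X A Y)).
Qed.

Lemma symmetry_unit_l A : symmetry unit_ob A ≡ id A.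
Proof.
eapply hom_eq_trans.
{ apply hom_eq_sym, (comp_strict_r _ (strict_unit_r A)). }
unfold symmetry. rewrite pair_proj1. apply strict_unit_l.
Qed.

Lemma exchange_unit X Y : exchange X unit_ob Y ≡ id (X ⊗ Y).
Proof.
rewrite <- strength_strong_tensor.
eapply hom_eq_trans; [apply hcast_hom_eq|].
rewrite <- tensor_id.
apply hom_eq_tensor; [apply hom_eq_refl|apply symmetry_unit_l].
Qed.

Lemma strength_hom_eq (F : StrongFunctor C) {X X' Y Y'} :
  X = X' -> Y = Y' -> strength F X Y ≡ strength F X' Y'.
Proof. intros [] []. apply hom_eq_refl. Qed.

Lemma strong_functor_eq (o : C -> C)
  (m : forall X Y : C, Hom X Y -> Hom (o X) (o Y))
  i i' c c' s s' n n' u u' a a' :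
  (forall X Y, s X Y = s' X Y) ->
  @Build_StrongFunctor C o m i c s n u a =
  @Build_StrongFunctor C o m i' c' s' n' u' a'.
Proof.
intros H.
assert (s = s') as <- by
  (extensionality X; extensionality Y; apply H).
f_equal; apply proof_irrelevance.
Qed.

Lemma strong_comp_assoc (F G H : StrongFunctor C) :
  strong_comp F (strong_comp G H) = strong_comp (strong_comp F G) H.
Proof.
apply strong_functor_eq. intros X Y. simpl.
now rewrite fmap_comp, comp_assoc.
Qed.

Lemma strong_comp_id_l (F : StrongFunctor C) : strong_comp (strong_id C) F = F.
Proof.
destruct F. apply strong_functor_eq. intros X Y. apply comp_id_l.
Qed.

Lemma strong_comp_id_r (F : StrongFunctor C) : strong_comp F (strong_id C) = F.
Proof.
destruct F as [o m i c s n u a]. apply strong_functor_eq. intros X Y. simpl.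
now rewrite i, comp_id_r.
Qed.

Lemma strong_nat_eq {F G : StrongFunctor C} (a b : StrongNat F G) :
  (forall X, component a X = component b X) -> a = b.
Proof.
destruct a as [a na sa], b as [b nb sb]. simpl. intros H.
assert (a = b) as <- by (extensionality X; apply H).
f_equal; apply proof_irrelevance.
Qed.

End Strictness.

(** * Stateful transformations and the operations on them *)

Section Stateful.
Context {C : StrictCartesianCategory}.

Definition stateful (U : StrongFunctor C) (A B : C) (W : StrongFunctor C) :=
  StrongNat (strong_comp (strong_tensor A) U) (strong_comp W (strong_tensor B)).

(* [component] with the composite functors unfolded in its type, without which
   rewriting with the laws of [comp] fails to match. *)
Definition arrow {U A B W} (a : stateful U A B W) (X : C) :
  Hom (U X ⊗ A) (W (X ⊗ B)) := component a X.

Lemma stateful_natural {U A B W} (a : stateful U A B W) {X Y : C} (f : Hom X Y) :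
  (fmap U f ⊠ id A) ;; arrow a Y = arrow a X ;; fmap W (f ⊠ id B).
Proof. exact (component_natural a f). Qed.

Lemma stateful_strong {U A B W} (a : stateful U A B W) (X Y : C) :
  (arrow a X ⊠ id Y) ;; strength W (X ⊗ B) Y ;; fmap W (exchange X B Y) =
  exchange (U X) A Y ;; (strength U X Y ⊠ id A) ;; arrow a (X ⊗ Y).
Proof.
rewrite <- !strength_strong_tensor, <- comp_assoc.
exact (component_strong a X Y).
Qed.

(** The trailing [g] allows rewriting inside right-bracketed composites. *)
Lemma stateful_strong_comp {U A B W} (a : stateful U A B W) (X Y D : C)
  (g : Hom (W (X ⊗ Y ⊗ B)) D) :
  (arrow a X ⊠ id Y) ;; (strength W (X ⊗ B) Y ;; (fmap W (exchange X B Y) ;; g)) =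
  exchange (U X) A Y ;; ((strength U X Y ⊠ id A) ;; (arrow a (X ⊗ Y) ;; g)).
Proof. rewrite !comp_assoc. now rewrite stateful_strong. Qed.

(** Stating strength through [exchange] keeps the casts of [strong_tensor] out of the construction
    of cells. *)
Definition mk_stateful {U : StrongFunctor C} {A B : C} {W : StrongFunctor C}
  (c : forall X : C, Hom (U X ⊗ A) (W (X ⊗ B)))
  (nat : forall (X Y : C) (f : Hom X Y),
    (fmap U f ⊠ id A) ;; c Y = c X ;; fmap W (f ⊠ id B))
  (strong : forall X Y : C,
    (c X ⊠ id Y) ;; strength W (X ⊗ B) Y ;; fmap W (exchange X B Y) =
    exchange (U X) A Y ;; (strength U X Y ⊠ id A) ;; c (X ⊗ Y)) :
  stateful U A B W.
Proof.
refine (Build_StrongNat (F := strong_comp (strong_tensor A) U)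
  (G := strong_comp W (strong_tensor B)) (component := c) nat _).
intros X Y. cbn [strong_comp strength fob].
rewrite !strength_strong_tensor, comp_assoc. apply strong.
Defined.

Definition stateful_hcomp_cell {U V W : StrongFunctor C} {A B A' B' : C}
  (a : stateful U A B V) (b : stateful V A' B' W) :
  stateful U (A ⊗ A') (B ⊗ B') W.
Proof.
refine (mk_stateful (fun X => associator_inv (U X) A A' ;;
  (arrow a X ⊠ id A') ;; arrow b (X ⊗ B) ;;
  fmap W (associator X B B')) _ _).
- intros X Y f.
  rewrite !comp_assoc, <- tensor_id, associator_inv_natural.
  rewrite <- (comp_assoc (associator_inv _ _ _)), <- tensor_id_comp.
  rewrite stateful_natural, tensor_id_comp, <- !comp_assoc.
    rewrite (comp_assoc (fmap V _ ⊠ _)), stateful_natural.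
  rewrite <- !comp_assoc, <- !fmap_comp, <- tensor_id.
  now rewrite associator_natural.
- intros X Y.
  rewrite !tensor_id_comp, <- !comp_assoc.
  rewrite (comp_assoc (fmap W _ ⊠ _)), strength_natural, <- !comp_assoc.
  (* The exchange with [B ⊗ B'] splits: the strength of [b] absorbs the part for [B'], and the part
     for [B] is left for [a]. *)
  rewrite <- fmap_comp, associator_exchange, !fmap_comp, <- !comp_assoc.
  rewrite stateful_strong_comp.
  (* Naturality of [b] carries the exchange of [B] with [Y] back across [b], under [fmap V]. *)
  rewrite (comp_assoc (arrow b _) (fmap W _)), <- stateful_natural.
  rewrite <- !comp_assoc, (comp_assoc (arrow a X ⊠ _ ⊠ _)), exchange_natural.
  (* Three factors are gathered under one [⊠ id A'], forming the left side of [stateful_strong] for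
     [a]. *)
  rewrite <- !comp_assoc, (comp_assoc (_ ⊠ _) (fmap V _ ⊠ _)), <- tensor_id_comp.
  rewrite (comp_assoc (_ ⊠ _) (_ ⊠ id A') (arrow b _ ;; _)), <- tensor_id_comp.
  rewrite comp_assoc.
  rewrite (comp_assoc (arrow a X ⊠ _)), stateful_strong, !tensor_id_comp.
  rewrite !comp_assoc, associator_inv_exchange, <- !comp_assoc.
  rewrite <- tensor_id, (comp_assoc (_ ⊠ (_ ⊠ _))), associator_inv_natural.
  now rewrite <- !comp_assoc.
Defined.

(** [id (U X)] does not have the type of a component here; the strength at the unit object does, and
    it is an identity arrow by [strength_unit]. *)
Definition stateful_hunit_cell (U : StrongFunctor C) :
  stateful U unit_ob unit_ob U.
Proof.
refine (mk_stateful (fun X => strength U X unit_ob) _ _).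
- intros X Y f. apply strength_natural.
(* Up to [≡], both sides reduce to [strength U X Y], all other factors being identity arrows. *)
- intros X Y. apply hom_eq_eq.
  eapply hom_eq_trans; [|apply hom_eq_sym].
  + apply (comp_strict_r (A' := U (X ⊗ Y))).
    rewrite <- (fmap_id U). apply fmap_hom_eq, exchange_unit.
  + eapply hom_eq_trans.
    { rewrite <- comp_assoc. apply (comp_strict_l _ (exchange_unit _ _)). }
    eapply hom_eq_trans; [apply (comp_strict_r _ (strength_unit U _))|].
    eapply hom_eq_trans; [apply tensor_unit_r|].
    apply hom_eq_sym.
    eapply hom_eq_trans; [apply (comp_strict_l (A' := U X ⊗ Y))|].
    * rewrite <- tensor_id.
      apply hom_eq_tensor; [apply strength_unit|apply hom_eq_refl].
    * apply strength_hom_eq; [apply unit_r_ob|reflexivity].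
Defined.

Definition stateful_vcomp_cell {U U' W W' : StrongFunctor C} {A B E : C}
  (a : stateful U A E W) (b : stateful U' E B W') :
  stateful (strong_comp U U') A B (strong_comp W W').
Proof.
refine (mk_stateful (U := strong_comp U U') (W := strong_comp W W')
  (fun X => arrow a (U' X) ;; fmap W (arrow b X)) _ _).
- intros X Y f. cbn [strong_comp fob fmap].
  rewrite comp_assoc, stateful_natural, <- !comp_assoc, <- !fmap_comp.
  now rewrite stateful_natural.
- intros X Y. cbn [strong_comp fob fmap strength].
  rewrite !tensor_id_comp, <- !comp_assoc.
  rewrite (comp_assoc (fmap W _ ⊠ _)), strength_natural, <- !comp_assoc.
  (* The strength of [b] under [fmap W] produces the exchange of [E] with [Y] that the strength of
     [a] at [U' X] consumes. *)
  rewrite <- !fmap_comp, (comp_assoc (arrow b X ⊠ _)), stateful_strong.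
  rewrite !fmap_comp, <- !comp_assoc, stateful_strong_comp.
  rewrite (comp_assoc (arrow a _) (fmap W (_ ⊠ _))), <- stateful_natural.
  now rewrite <- !comp_assoc.
Defined.

Definition stateful_vunit_cell (A : C) :
  stateful (strong_id C) A A (strong_id C).
Proof.
refine (mk_stateful (U := strong_id C) (W := strong_id C)
  (fun X => id (X ⊗ A)) _ _).
- intros X Y f. simpl. now rewrite comp_id_l, comp_id_r.
- intros X Y. simpl. now rewrite !tensor_id, !comp_id_l, !comp_id_r.
Defined.

(** * The horizontal laws and interchange on components *)

Lemma arrow_hcomp {U V W A B A' B'} (a : stateful U A B V)
  (b : stateful V A' B' W) (X : C) :
  arrow (stateful_hcomp_cell a b) X ≡ (arrow a X ⊠ id A') ;; arrow b (X ⊗ B).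
Proof.
eapply hom_eq_trans.
{ apply (comp_strict_r (A' := W (X ⊗ B ⊗ B'))).
  rewrite <- fmap_id. apply fmap_hom_eq, strict_assoc. }
rewrite <- comp_assoc. apply (comp_strict_l _ (strict_assoc_inv _ _ _)).
Qed.

Lemma arrow_hom_eq {U A B W} (a : stateful U A B W) {X X' : C} :
  X = X' -> arrow a X ≡ arrow a X'.
Proof. intros []. apply hom_eq_refl. Qed.

Lemma arrow_hcomp_assoc {U V W Z A B A' B' A'' B''} (a : stateful U A B V)
  (b : stateful V A' B' W) (c : stateful W A'' B'' Z) (X : C) :
  arrow (stateful_hcomp_cell a (stateful_hcomp_cell b c)) X ≡
  arrow (stateful_hcomp_cell (stateful_hcomp_cell a b) c) X.
Proof.
eapply hom_eq_trans; [apply arrow_hcomp|].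
eapply hom_eq_trans; [|apply hom_eq_sym, arrow_hcomp].
eapply hom_eq_trans.
(* Tensoring with [A' ⊗ A''] amounts to tensoring with [A'] and then with [A'']. *)
{ apply (hom_eq_comp (f' := arrow a X ⊠ id A' ⊠ id A'')); [|apply arrow_hcomp].
  rewrite <- tensor_id. apply hom_eq_sym, tensor_assoc. }
rewrite comp_assoc, <- tensor_id_comp.
apply hom_eq_comp; [|apply arrow_hom_eq, assoc_ob].
apply hom_eq_tensor; [apply hom_eq_sym, arrow_hcomp|apply hom_eq_refl].
Qed.

Lemma arrow_hcomp_hunit_l {U W A B} (a : stateful U A B W) (X : C) :
  arrow (stateful_hcomp_cell (stateful_hunit_cell U) a) X ≡ arrow a X.
Proof.
eapply hom_eq_trans; [apply arrow_hcomp|].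
eapply hom_eq_trans; [apply (comp_strict_l (A' := U X ⊗ A))|].
- rewrite <- tensor_id.
  apply hom_eq_tensor; [apply strength_unit|apply hom_eq_refl].
- apply arrow_hom_eq, unit_r_ob.
Qed.

Lemma arrow_hcomp_hunit_r {U W A B} (a : stateful U A B W) (X : C) :
  arrow (stateful_hcomp_cell a (stateful_hunit_cell W)) X ≡ arrow a X.
Proof.
eapply hom_eq_trans; [apply arrow_hcomp|].
eapply hom_eq_trans; [apply (comp_strict_r _ (strength_unit W _))|].
apply tensor_unit_r.
Qed.

(** Naturality of [c] along [arrow b X] swaps the two middle cells, and the associators between the
    two rows on the right side cancel. *)
Lemma arrow_interchange {U V W U' V' W' A B E A' B' E'}
  (a : stateful U A E V) (b : stateful U' E B V')
  (c : stateful V A' E' W) (d : stateful V' E' B' W') (X : C) :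
  arrow (stateful_hcomp_cell (stateful_vcomp_cell a b)
    (stateful_vcomp_cell c d)) X =
  arrow (stateful_vcomp_cell (stateful_hcomp_cell a c)
    (stateful_hcomp_cell b d)) X.
Proof.
change (associator_inv (U (U' X)) A A' ;;
    ((arrow a (U' X) ;; fmap V (arrow b X)) ⊠ id A') ;;
    (arrow c (V' (X ⊗ B)) ;; fmap W (arrow d (X ⊗ B))) ;;
    fmap W (fmap W' (associator X B B')) =
  associator_inv (U (U' X)) A A' ;; (arrow a (U' X) ⊠ id A') ;;
    arrow c (U' X ⊗ E) ;; fmap W (associator (U' X) E E') ;;
    fmap W (associator_inv (U' X) E E' ;; (arrow b X ⊠ id E') ;;
      arrow d (X ⊗ B) ;; fmap W' (associator X B B'))).
rewrite tensor_id_comp, !fmap_comp, <- !comp_assoc.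
rewrite (comp_assoc (fmap V _ ⊠ _)), stateful_natural.
rewrite (comp_assoc (fmap W (associator _ _ _))),
  <- (fmap_comp W (associator _ _ _)).
now rewrite associator_inv_r, fmap_id, comp_id_l, <- !comp_assoc.
Qed.

End Stateful.

(** * Assembling the double category *)

Section DoubleCategory.
Variable C : StrictCCC.

Definition stateful_operations : CellOperations (stateful_boundaries C) :=
  Build_CellOperations (D := stateful_boundaries C)
    (@stateful_hcomp_cell C) (@stateful_hunit_cell C)
    (@stateful_vcomp_cell C) (@stateful_vunit_cell C).

(** Once equal boundaries are identified, [≡] between components is plain equality, so no cell has
    to be transported. *)
Lemma stateful_cell_eq {U U' W W' : StrongFunctor C} {A A' B B' : C}
  (a : stateful U A B W) (a' : stateful U' A' B' W') :
  U = U' -> A = A' -> B = B' -> W = W' ->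
  (forall X, arrow a X ≡ arrow a' X) ->
  @cell_eq (stateful_boundaries C) U A B W a U' A' B' W' a'.
Proof.
intros <- <- <- <- H.
assert (a = a') as <-
  by (apply strong_nat_eq; intros X; apply hom_eq_eq, H).
apply cell_eq_refl.
Qed.

Lemma ob_monoid : is_monoid (fun A B : C => A ⊗ B) unit_ob.
Proof.
split; [intros; symmetry; apply assoc_ob|apply unit_l_ob|apply unit_r_ob].
Qed.

Lemma strong_functor_monoid : is_monoid (@strong_comp C) (strong_id C).
Proof.
split; [apply strong_comp_assoc|apply strong_comp_id_l|apply strong_comp_id_r].
Qed.

Lemma stateful_operations_spec : is_stateful_operations stateful_operations.
Proof.
split.
- intros. apply arrow_hcomp.
- intros. apply strength_unit.
- reflexivity.
- reflexivity.
Qed.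

Lemma stateful_double_category :
  is_single_object_double_category stateful_operations.
Proof.
split.
- exact ob_monoid.
- exact strong_functor_monoid.
- intros. apply stateful_cell_eq; try reflexivity.
  + apply ob_monoid.
  + apply ob_monoid.
  + apply arrow_hcomp_assoc.
- intros. apply stateful_cell_eq; try reflexivity.
  + apply ob_monoid.
  + apply ob_monoid.
  + apply arrow_hcomp_hunit_l.
- intros. apply stateful_cell_eq; try reflexivity.
  + apply ob_monoid.
  + apply ob_monoid.
  + apply arrow_hcomp_hunit_r.
- intros U U' U'' W W' W'' A B E E' a b c.
  apply stateful_cell_eq; try reflexivity.
  + apply strong_functor_monoid.
  + apply strong_functor_monoid.
  + intros X. apply eq_hom_eq.
    change (arrow a (U' (U'' X)) ;;
        fmap W (arrow b (U'' X) ;; fmap W' (arrow c X)) =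
      arrow a (U' (U'' X)) ;; fmap W (arrow b (U'' X)) ;;
        fmap W (fmap W' (arrow c X))).
    now rewrite fmap_comp, comp_assoc.
- intros U W A B a. apply stateful_cell_eq; try reflexivity.
  + apply strong_functor_monoid.
  + apply strong_functor_monoid.
  + intros X. apply eq_hom_eq, comp_id_l.
- intros U W A B a. apply stateful_cell_eq; try reflexivity.
  + apply strong_functor_monoid.
  + apply strong_functor_monoid.
  + intros X. apply eq_hom_eq.
    change (arrow a X ;; fmap W (id (X ⊗ B)) = arrow a X).
    now rewrite fmap_id, comp_id_r.
(* The strength of [strong_id] is an identity by definition. *)
- apply strong_nat_eq. reflexivity.
- intros A B. apply strong_nat_eq. intros X.
  change (id (X ⊗ (A ⊗ B)) =
    associator_inv X A B ;; (id (X ⊗ A) ⊠ id B) ;; id (X ⊗ A ⊗ B) ;;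
      associator X A B).
  now rewrite tensor_id, !comp_id_r, associator_inv_l.
(* The strength of [strong_comp U W] at the unit object is by definition the vertical composite of
   the two strengths. *)
- intros U W. now apply strong_nat_eq.
- intros. apply strong_nat_eq. intros X. apply arrow_interchange.
Qed.

End DoubleCategory.

Theorem lemma4 (C : StrictCCC) :
  exists S : CellOperations (stateful_boundaries C),
    is_stateful_operations S /\ is_single_object_double_category S.
Proof.
exists (stateful_operations C).
split; [apply stateful_operations_spec|apply stateful_double_category].
Qed.
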